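(* Suppose that every bridgeless cubic graph admits a Petersen coloring (the Petersen Coloring Conjecture). Then every bridgeless cubic graph $G$ admits a list $(E_0,E_1,E_2,E_3,E_4)$ of five even subgraphs such that every edge of $G$ belongs to exactly two of them and $|E_0|\geq \frac{3}{5}|E(G)|$.
   Context: Graphs are finite and loopless but may have parallel edges. A cubic graph is one in which every vertex has degree $3$. An even subgraph is (the edge set of) a subgraph in which every vertex has even degree (possibly empty). For a vertex $v$ of a graph $G$, $\partial_G(v)$ denotes the set of edges incident to $v$. For cubic graphs $G,H$, an $H$-coloring of $G$ is a map $\phi:E(G)\to E(H)$ such that for every $v\in V(G)$ there is $w\in V(H)$ with $\phi(\partial_G(v))=\partial_H(w)$. A Petersen coloring of $G$ is a $P_{10}$-coloring of $G$, where $P_{10}$ is the Petersen graph. *)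

(* Defs.v *)
From mathcomp Require Export all_boot all_order all_algebra.

Set Implicit Arguments.
Unset Strict Implicit.
Unset Printing Implicit Defensive.

(* Parallel edges are distinct elements of [edge] with the same [ends]; having
   exactly two ends excludes loops. *)
Record mgraph := MGraph {
  vertex : finType;
  edge : finType;
  ends : edge -> {set vertex};
  card_ends : forall e, #|ends e| = 2
}.

Definition incident (G : mgraph) (v : vertex G) : {set edge G} :=
  [set e | v \in ends e].

(* As there are no loops, the degree of v is the number of incident edges. *)
Definition cubic (G : mgraph) : Prop :=
  forall v : vertex G, #|incident v| = 3.

Definition adj (G : mgraph) (F : {set edge G}) : rel (vertex G) :=
  fun x y => [exists e in F, ends e == [set x; y]].

Lemma adj_sym (G : mgraph) (F : {set edge G}) : symmetric (adj F).
Proof. by move=> x y; rewrite /adj setUC. Qed.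

(* [n_comp] counts connected components because [adj F] is symmetric. *)
Definition components (G : mgraph) (F : {set edge G}) : nat :=
  n_comp (adj F) predT.

Definition bridge (G : mgraph) (e : edge G) : Prop :=
  components [set: edge G] < components [set~ e].

Definition bridgeless (G : mgraph) : Prop := forall e : edge G, ~ bridge e.

Definition even_subgraph (G : mgraph) (F : {set edge G}) : Prop :=
  forall v : vertex G, ~~ odd #|F :&: incident v|.

Definition coloring (H G : mgraph) (phi : edge G -> edge H) : Prop :=
  forall v : vertex G, exists w : vertex H, phi @: incident v = incident w.

(* The Petersen graph as the generalized Petersen graph GP(5,2): vertices
   (false, i) form the outer 5-cycle and (true, i) the inner pentagram;
   [ordS] is i |-> i + 1 mod 5. *)
Definition petersen_ends (e : 'I_5 + 'I_5 + 'I_5) : {set bool * 'I_5} :=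
  match e with
  | inl (inl i) => [set (false, i); (false, ordS i)]
  | inl (inr i) => [set (false, i); (true, i)]
  | inr i => [set (true, i); (true, ordS (ordS i))]
  end.

Lemma card_petersen_ends e : #|petersen_ends e| = 2.
Proof.
by case: e => [[i|i]|i] /=; rewrite cards2 xpair_eqE //=;
  case: i => [[|[|[|[|[|]]]]]].
Qed.

Definition petersen : mgraph := MGraph card_petersen_ends.

Lemma petersen_cubic : cubic petersen.
Proof.
case=> b i; rewrite -sum1_card big_mkcond !big_sumType /= !big_ord_recl !big_ord0.
rewrite !inE /= !xpair_eqE.
by case: b; case: i => [[|[|[|[|[|]]]]]].
Qed.

Definition petersen_coloring (G : mgraph) (phi : edge G -> edge petersen) : Prop :=
  coloring phi.

(* Main.v *)
Require Import Defs.
From mathcomp Require Import all_boot all_order all_algebra.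
From mathcomp Require Import lra.

(** A coloring of cubic graphs is injective around each vertex, so even
    subgraphs pull back to even subgraphs along it, and so do double covers.
    It remains to find a suitable double cover of the Petersen graph, where an
    edge e carries weight #|phi^-1(e)|. We use two double covers by five even
    subgraphs whose first member is a 9-cycle, together with their rotations by
    Z/5: these ten 9-cycles cover each of the 15 edges exactly six times, so one
    of them has at least 6/10 of the total weight. *)

(** The three edges at [v] have an image that again consists of three edges. *)
Lemma coloring_inj (H G : mgraph) (phi : edge G -> edge H) (v : vertex G) :
  cubic H -> cubic G -> coloring phi -> {in incident v &, injective phi}.
Proof.
move=> H3 G3 phiC; apply/imset_injP.
by have [w ->] := phiC v; rewrite H3 G3.
Qed.

(** By injectivity, [phi] maps the edges of the preimage at [v] bijectively onto the edges of [F] at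
    [w]. *)
Lemma even_subgraph_preimset (H G : mgraph) (phi : edge G -> edge H)
    (F : {set edge H}) :
  cubic H -> cubic G -> coloring phi ->
  even_subgraph F -> even_subgraph (phi @^-1: F).
Proof.
move=> H3 G3 phiC Feven v; have [w phi_v] := phiC v.
suff <- : #|F :&: incident w| = #|phi @^-1: F :&: incident v| by exact: Feven.
have inj_v := @coloring_inj _ _ _ v H3 G3 phiC.
rewrite -phi_v -(card_in_imset (f := phi) (D := _ :&: _)); last first.
  by move=> x y /setIP[_ xv] /setIP[_ yv]; apply: inj_v.
apply: eq_card => y; rewrite inE; apply/andP/imsetP => [[yF /imsetP[x xv def_y]]|].
  by exists x => //; rewrite !inE -def_y yF; rewrite inE in xv.
by case=> x /setIP[xF xv] ->; rewrite inE in xF; split=> //; apply: imset_f.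
Qed.

(* The two members of the cover containing an edge, listed along the outer
   cycle, the spokes and the pentagram. The 9-cycle labelled 0 meets these three
   classes in 4, 2, 3 edges for [c = true] and in 2, 4, 3 edges for [c = false],
   which averages to 3 in each class. *)
Definition petersen_labels (c : bool) : seq (nat * nat) * seq (nat * nat) * seq (nat * nat) :=
  if c then ([:: (0, 1); (0, 2); (0, 3); (0, 1); (1, 4)],
             [:: (0, 4); (1, 2); (2, 3); (1, 3); (0, 4)],
             [:: (3, 4); (0, 1); (2, 4); (0, 3); (0, 2)])
  else ([:: (0, 1); (1, 2); (0, 1); (1, 3); (1, 4)],
        [:: (0, 4); (0, 2); (0, 2); (0, 3); (3, 4)],
        [:: (2, 4); (2, 3); (0, 4); (0, 2); (0, 3)]).

(** Shifting the index by [k] is a rotation of GP(5,2). Reduction mod 5 keeps the default [(0, 0)]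
    out of reach. *)
Definition petersen_label (ck : bool * 'I_5) (e : edge petersen) : nat * nat :=
  let: (c, k) := ck in
  let: (outer, spokes, inner) := petersen_labels c in
  let: (s, j) := match e with
    | inl (inl j) => (outer, j)
    | inl (inr j) => (spokes, j)
    | inr j => (inner, j)
    end in
  nth (0, 0) s ((j + k) %% 5).

Definition petersen_cover (ck : bool * 'I_5) (i : 'I_5) : {set edge petersen} :=
  [set e | let: (a, b) := petersen_label ck e in ((i : nat) == a) || ((i : nat) == b)].

Lemma petersen_cover_even ck i : even_subgraph (petersen_cover ck i).
Proof.
case: ck => c k [b j].
(* Once the cardinal is a sum of fifteen explicit terms, each case is settled by computation. *)
rewrite -sum1_card big_mkcond !big_sumType /= !big_ord_recl !big_ord0 !inE /= !xpair_eqE.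
by case: c; case: k => [[|[|[|[|[|]]]]] //= ?]; case: b;
   case: j => [[|[|[|[|[|]]]]] //= ?]; case: i => [[|[|[|[|[|]]]]]].
Qed.

Lemma petersen_cover_double ck e : #|[set i | e \in petersen_cover ck i]| = 2.
Proof.
case: ck => c k.
rewrite -sum1_card big_mkcond !big_ord_recl !big_ord0 !inE /=.
by case: c; case: k => [[|[|[|[|[|]]]]] //= ?];
   case: e => [[|]|] [[|[|[|[|[|]]]]]].
Qed.

(** As [k] varies, the rotations of [e] run through its whole class, so the two values of [c]
    contribute 4 + 2, 2 + 4 or 3 + 3. *)
Lemma petersen_cover_first e : \sum_ck (e \in petersen_cover ck ord0) = 6.
Proof.
transitivity (\sum_c \sum_k (e \in petersen_cover (c, k) ord0)).
  by rewrite pair_bigA; apply: eq_bigr => -[].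
rewrite big_bool /= !big_ord_recl !big_ord0 !inE /=.
by case: e => [[|]|] [[|[|[|[|[|]]]]]].
Qed.

Lemma petersen_cover_heavy (T : finType) (phi : T -> edge petersen) :
  exists ck, 3 * #|T| <= 5 * #|phi @^-1: petersen_cover ck ord0|.
Proof.
apply/existsP; apply: contraT; rewrite negb_exists => /forallP light.
have total : \sum_ck #|phi @^-1: petersen_cover ck ord0| = 6 * #|T|.
  under eq_bigr => ck _ do rewrite -sum1_card big_mkcond /=.
  rewrite exchange_big /= mulnC -sum_nat_const.
  apply: eq_bigr => x _; rewrite -(petersen_cover_first (phi x)).
  by apply: eq_bigr => ck _; rewrite inE; case: ifP.
(* Summing the ten strict inequalities gives 30 * #|T| + 10 <= 30 * #|T|, which is absurd. *)
have : \sum_(ck : bool * 'I_5) (5 * #|phi @^-1: petersen_cover ck ord0|).+1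
       <= \sum_(ck : bool * 'I_5) 3 * #|T|.
  by apply: leq_sum => ck _; rewrite ltnNge; apply: light.
under eq_bigr => ck _ do rewrite -addn1.
rewrite big_split /= -big_distrr /= total !sum_nat_const card_prod card_bool card_ord.
by rewrite mulnA [leqRHS]mulnA -[leqRHS]addn0 leq_add2l.
Qed.

Theorem theorem3p5
  (petersen_coloring_conjecture :
     forall G : mgraph, cubic G -> bridgeless G ->
       exists phi : edge G -> edge petersen, petersen_coloring phi)
  (G : mgraph) (G_cubic : cubic G) (G_bridgeless : bridgeless G) :
  exists E : 'I_5 -> {set edge G},
    [/\ forall i : 'I_5, even_subgraph (E i),
        forall e : edge G, #|[set i : 'I_5 | e \in E i]| = 2
      & (3 / 5 * #|edge G|%:R <= #|E ord0|%:R :> rat)%R].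
Proof.
have [phi phiC] := petersen_coloring_conjecture G G_cubic G_bridgeless.
have [ck heavy] := petersen_cover_heavy _ phi.
exists (fun i => phi @^-1: petersen_cover ck i); split=> [i | e |].
- exact: even_subgraph_preimset petersen_cubic _ phiC (petersen_cover_even ck i).
- rewrite -[RHS](petersen_cover_double ck (phi e)).
  by apply: eq_card => i; rewrite !inE.
- by move: heavy; rewrite -(Num.Theory.ler_nat rat) !GRing.natrM; lra.
Qed.
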